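(* Let $d\ge 1$ and $r_1,\dots,r_d\ge1$ be integers, and for $i=1,\dots,d$ let $w_i=z_{k_{i,1}}\cdots z_{k_{i,r_i}}$ with positive integers $k_{i,j}$. Then in $\mathcal{A}$, \begin{align*} &\sum_{i=1}^{d} Z_{\mathcal{A}}^{\mathrm{cyc}}\bigl(w_{1}\otimes\cdots\otimes w_{i-1}\otimes(y\,\widetilde{\sqcup\!\sqcup}\, w_{i})\otimes w_{i+1}\otimes\cdots\otimes w_{d}\bigr)\\ &=2\sum_{i=1}^{d}\sum_{j=1}^{r_i} Z_{\mathcal{A}}^{\mathrm{cyc}}\bigl(w_{1}\otimes\cdots\otimes w_{i-1}\otimes z_{k_{i,1}}\cdots z_{k_{i,j-1}}z_{k_{i,j}+1}z_{k_{i,j+1}}\cdots z_{k_{i,r_i}}\otimes w_{i+1}\otimes\cdots\otimes w_{d}\bigr). \end{align*}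
   Context: Let $\mathcal{A}=\bigl(\prod_p\mathbb{Z}/p\mathbb{Z}\bigr)/\bigl(\bigoplus_p\mathbb{Z}/p\mathbb{Z}\bigr)$, $p$ running over all primes. Let $\mathfrak{H}=\mathbb{Q}\langle x,y\rangle$ (noncommutative polynomials) and $z_k:=yx^{k-1}$ for $k\ge1$. The shuffle product $\sqcup\!\sqcup$ on $\mathfrak{H}$ is the $\mathbb{Q}$-bilinear product with $1\sqcup\!\sqcup w=w\sqcup\!\sqcup 1=w$ and $wu\sqcup\!\sqcup w'u'=(w\sqcup\!\sqcup w'u')u+(wu\sqcup\!\sqcup w')u'$ for words $w,w'$ and letters $u,u'\in\{x,y\}$. Define $y\,\widetilde{\sqcup\!\sqcup}\, z_k:=-y^2$ if $k=1$, $:=0$ if $k=2$, $:=yx(y\sqcup\!\sqcup x^{k-3})x$ if $k\ge3$, and extend by $y\,\widetilde{\sqcup\!\sqcup}\, z_{k_1}\cdots z_{k_r}:=\sum_{l=1}^r z_{k_1}\cdots z_{k_{l-1}}(y\,\widetilde{\sqcup\!\sqcup}\, z_{k_l})z_{k_{l+1}}\cdots z_{k_r}$ (and $\mathbb{Q}$-linearly). Let $\mathfrak{H}^{\mathrm{cyc}}$ be the subspace of $\bigoplus_{d\ge1}\mathfrak{H}^{\otimes d}$ spanned by $w_1\otimes\cdots\otimes w_d$ with all $w_i\in y\mathfrak{H}$ (every word in $y\mathfrak{H}$ is uniquely a product of $z_k$'s). For a multi-index $\boldsymbol{k}=[\boldsymbol{k}_1,\dots,\boldsymbol{k}_d]$,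 $\boldsymbol{k}_i=(k_{i,1},\dots,k_{i,r_i})\in\mathbb{Z}_{\ge1}^{r_i}$, $r=r_1+\cdots+r_d$, define $\zeta^{\mathrm{cyc}}_{\mathcal{A}}(\boldsymbol{k})=\bigl(\sum_{S_p}\prod_{i=1}^d\prod_{j=1}^{r_i}n_{i,j}^{-k_{i,j}}\bmod p\bigr)_p\in\mathcal{A}$, where $S_p$ is the set of $(n_{1,1},\dots,n_{d,r_d})\in\{1,\dots,p-1\}^r$ with $n_{i,1}<\cdots<n_{i,r_i}$ for all $i$ and $n_{1,1}\le n_{2,r_2},\dots,n_{d-1,1}\le n_{d,r_d}$, $n_{d,1}\le n_{1,r_1}$. Define the $\mathbb{Q}$-linear map $Z^{\mathrm{cyc}}_{\mathcal{A}}:\mathfrak{H}^{\mathrm{cyc}}\to\mathcal{A}$ by $Z^{\mathrm{cyc}}_{\mathcal{A}}(z_{k_{1,1}}\cdots z_{k_{1,r_1}}\otimes\cdots\otimes z_{k_{d,1}}\cdots z_{k_{d,r_d}})=\zeta^{\mathrm{cyc}}_{\mathcal{A}}([(k_{1,1},\dots,k_{1,r_1}),\dots,(k_{d,1},\dots,k_{d,r_d})])$. *)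

(* Defs.v *)
From HB Require Import structures.
From mathcomp Require Import all_boot all_order all_algebra.
From mathcomp Require Import ring_quotient generic_quotient.
From mathcomp Require Import boolp finmap monalg ring zify.

Set Implicit Arguments.
Unset Strict Implicit.
Unset Printing Implicit Defensive.

Import GRing.Theory.
Local Open Scope ring_scope.

Definition primeN : Type := {p : nat | prime p}.
HB.instance Definition _ := Choice.on primeN.

Definition prodFp : Type := forall p : primeN, 'F_(val p).
HB.instance Definition _ := Choice.on prodFp.

Section ProdFp.
Implicit Types f g h : prodFp.

Lemma prodFpP f g : (forall p, f p = g p) -> f = g.
Proof. exact: functional_extensionality_dep. Qed.

Definition pf0 : prodFp := fun=> 0.
Definition pf1 : prodFp := fun=> 1.
Definition pfN f : prodFp := fun p => - f p.
Definition pfD f g : prodFp := fun p => f p + g p.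
Definition pfM f g : prodFp := fun p => f p * g p.

Fact pfDA : associative pfD.
Proof. by move=> f g h; apply: prodFpP => p; exact: addrA. Qed.
Fact pfDC : commutative pfD.
Proof. by move=> f g; apply: prodFpP => p; exact: addrC. Qed.
Fact pf0D : left_id pf0 pfD.
Proof. by move=> f; apply: prodFpP => p; exact: add0r. Qed.
Fact pfND : left_inverse pf0 pfN pfD.
Proof. by move=> f; apply: prodFpP => p; exact: addNr. Qed.
Fact pfMA : associative pfM.
Proof. by move=> f g h; apply: prodFpP => p; exact: mulrA. Qed.
Fact pfMC : commutative pfM.
Proof. by move=> f g; apply: prodFpP => p; exact: mulrC. Qed.
Fact pf1M : left_id pf1 pfM.
Proof. by move=> f; apply: prodFpP => p; exact: mul1r. Qed.
Fact pfMDl : left_distributive pfM pfD.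
Proof. by move=> f g h; apply: prodFpP => p; exact: mulrDl. Qed.
Fact pf1_neq0 : pf1 != pf0.
Proof.
apply/eqP => /(congr1 (fun f => f (exist (fun p => prime p) 2 isT))).
by move/eqP; rewrite oner_eq0.
Qed.

HB.instance Definition _ := GRing.isZmodule.Build prodFp pfDA pfDC pf0D pfND.
HB.instance Definition _ :=
  GRing.Zmodule_isComNzRing.Build prodFp pfMA pfMC pf1M pfMDl pf1_neq0.

End ProdFp.

(* sumFp is the direct sum inside the product. *)
Definition sumFp (f : prodFp) : bool :=
  `[< exists s : seq primeN, forall p, f p != 0 -> p \in s >].

Lemma primeN_above (s : seq primeN) (n : nat) :
  exists2 p, p \notin s & (n < val p)%N.
Proof.
pose N := \max_(p <- s) val p.
case: (prime_above (maxn n N)) => q; rewrite gtn_max => /andP[nq Nq] pq.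
exists (exist (fun p => prime p) q pq) => //.
apply/negP => qs.
have := @leq_bigmax_seq _ s xpredT (fun p : primeN => val p) _ qs isT.
by rewrite leqNgt Nq.
Qed.

Fact sumFp_idealr : idealr_closed sumFp.
Proof.
split.
- by apply/asboolP; exists [::] => p; rewrite eqxx.
- apply/asboolP => -[s hs].
  have [p /negP ps _] := primeN_above s 0.
  by apply/ps/hs/oner_neq0.
- move=> a f g /asboolP[s hs] /asboolP[t ht]; apply/asboolP.
  exists (s ++ t) => p; rewrite mem_cat; apply: contraR.
  rewrite negb_or => /andP[ps pt].
  have -> : (a * f + g) p = a p * f p + g p by [].
  have /eqP -> : f p == 0 by apply: contraNT ps => /hs.
  have /eqP -> : g p == 0 by apply: contraNT pt => /ht.
  by rewrite mulr0 addr0.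
Qed.

HB.instance Definition _ := isIdealr.Build prodFp sumFp sumFp_idealr.

Definition sumFpI : idealr prodFp := Idealr.clone prodFp sumFp _.

Definition A : Type := {ideal_quot sumFpI}.
HB.instance Definition _ := GRing.ComNzRing.on A.

Definition clA (f : prodFp) : A := \pi_({ideal_quot sumFpI})%qT f.

Lemma clA_eq f g :
  clA f = clA g <-> exists s : seq primeN, forall p, f p != g p -> p \in s.
Proof.
rewrite /clA; split.
  move=> /eqP; rewrite -Quotient.idealrBE => /asboolP[s hs].
  by exists s => p fgp; apply: hs; rewrite subr_eq0.
move=> [s hs]; apply/eqP; rewrite -Quotient.idealrBE; apply/asboolP.
by exists s => p; rewrite subr_eq0 => /hs.
Qed.

Lemma clA_eq_gt N f g : (forall p, (N < val p)%N -> f p = g p) -> clA f = clA g.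
Proof.
move=> h; apply/clA_eq.
exists (pmap insub (iota 0 N.+1)) => p fgp; rewrite mem_pmap_sub mem_iota /=.
rewrite add0n ltnS leqNgt; apply/negP => /h /eqP; exact/negP.
Qed.

Fact clA_zmod_morphism : zmod_morphism clA.
Proof. exact: (rmorphB (\pi_({ideal_quot sumFpI})%qT)). Qed.
Fact clA_monoid_morphism : monoid_morphism clA.
Proof.
split; first exact: (rmorph1 (\pi_({ideal_quot sumFpI})%qT)).
exact: (rmorphM (\pi_({ideal_quot sumFpI})%qT)).
Qed.
HB.instance Definition _ :=
  GRing.isZmodMorphism.Build prodFp A clA clA_zmod_morphism.
HB.instance Definition _ :=
  GRing.isMonoidMorphism.Build prodFp A clA clA_monoid_morphism.

(* The structural map Q -> A. At the finitely many p dividing the denominator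
   of q, ratr q is a junk value, which does not affect the class. *)
Definition ratA (q : rat) : A := clA (fun p => ratr q).

Lemma intFp_eq0 (p : primeN) (m : int) :
  ((m%:~R : 'F_(val p)) == 0) = (val p %| `|m|)%N.
Proof.
case: p => p pp /=.
have chp : p \in [pchar 'F_p] by exact: pchar_Fp.
by case: m => n; rewrite ?NegzE ?mulrNz ?oppr_eq0 ?abszN -pmulrn
  (dvdn_pcharf chp).
Qed.

Lemma denFp_neq0 (p : primeN) (q : rat) :
  (`|denq q| < val p)%N -> (denq q)%:~R != 0 :> 'F_(val p).
Proof.
move=> ltp; rewrite intFp_eq0; apply/negP => /dvdn_leq.
by rewrite absz_gt0 denq_neq0 leqNgt ltp => /(_ isT).
Qed.

Lemma ratA1 : ratA 1 = 1.
Proof.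
rewrite -[RHS](rmorph1 clA); apply: (@clA_eq_gt 0) => p _.
exact: (ratr_nat _ 1).
Qed.

Lemma ratAD q1 q2 : ratA (q1 + q2) = ratA q1 + ratA q2.
Proof.
rewrite /ratA -rmorphD.
apply: (@clA_eq_gt (`|denq (q1 + q2)%R| + (`|denq q1| + `|denq q2|)))%N => p ltp.
have d1 : (denq q1)%:~R != 0 :> 'F_(val p) by apply: denFp_neq0; lia.
have d2 : (denq q2)%:~R != 0 :> 'F_(val p) by apply: denFp_neq0; lia.
have d12 : (denq (q1 + q2))%:~R != 0 :> 'F_(val p) by apply: denFp_neq0; lia.
change (ratr (q1 + q2) = ratr q1 + ratr q2 :> 'F_(val p)).
rewrite /ratr addf_div //; apply/eqP.
rewrite eqr_div ?mulf_neq0 // -!intrM -intrD -intrM; apply/eqP; congr _%:~R.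
apply: (@intr_inj rat); rewrite !(intrM, intrD) !numqE; ring.
Qed.

Lemma ratAM q1 q2 : ratA (q1 * q2) = ratA q1 * ratA q2.
Proof.
rewrite /ratA -rmorphM.
apply: (@clA_eq_gt (`|denq (q1 * q2)%R| + (`|denq q1| + `|denq q2|)))%N => p ltp.
have d1 : (denq q1)%:~R != 0 :> 'F_(val p) by apply: denFp_neq0; lia.
have d2 : (denq q2)%:~R != 0 :> 'F_(val p) by apply: denFp_neq0; lia.
have d12 : (denq (q1 * q2))%:~R != 0 :> 'F_(val p) by apply: denFp_neq0; lia.
change (ratr (q1 * q2) = ratr q1 * ratr q2 :> 'F_(val p)).
rewrite /ratr mulf_div; apply/eqP.
rewrite eqr_div ?mulf_neq0 // -!intrM; apply/eqP; congr _%:~R.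
apply: (@intr_inj rat); rewrite !intrM !numqE; ring.
Qed.

Definition scaleA (q : rat) (a : A) : A := ratA q * a.

Fact scaleAA q1 q2 a : scaleA q1 (scaleA q2 a) = scaleA (q1 * q2) a.
Proof. by rewrite /scaleA ratAM mulrA. Qed.
Fact scaleA1 : left_id 1 scaleA.
Proof. by move=> a; rewrite /scaleA ratA1 mul1r. Qed.
Fact scaleADr : right_distributive scaleA +%R.
Proof. by move=> q a b; rewrite /scaleA mulrDr. Qed.
Fact scaleADl a : {morph scaleA^~ a : q1 q2 / q1 + q2}.
Proof. by move=> q1 q2; rewrite /scaleA ratAD mulrDl. Qed.

HB.instance Definition _ :=
  GRing.Zmodule_isLmodule.Build rat A scaleAA scaleA1 scaleADr scaleADl.

Section LinearExtension.
Context (K : choiceType) (V : lmodType rat) (F : K -> V).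

Definition linext (f : {malg rat[K]}) : V := \sum_(k <- msupp f) f@_k *: F k.

Lemma linextEw (D : {fset K}) f :
  (msupp f `<=` D)%fset -> linext f = \sum_(k <- D) f@_k *: F k.
Proof.
move=> le; rewrite [LHS](big_fset_incl _ le) => //= k _ /mcoeff_outdom ->.
by rewrite scale0r.
Qed.

Fact linext_is_linear : linear linext.
Proof.
move=> c f g.
pose D := (msupp (c *: f + g) `|` (msupp f `|` msupp g))%fset.
rewrite !(@linextEw D) ?fsubsetUl //;
  try by rewrite fsubsetU ?fsubsetUl ?fsubsetUr ?orbT.
rewrite scaler_sumr -big_split /=; apply: eq_bigr => k _.
by rewrite mcoeffD mcoeffZ scalerDl scalerA.
Qed.

HB.instance Definition _ :=
  GRing.isLinear.Build rat {malg rat[K]} V *:%R linext linext_is_linear.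

Lemma linextU k : linext << k >> = F k.
Proof. by rewrite (linextEw msuppU_le) big_seq_fset1 mcoeffUU scale1r. Qed.

End LinearExtension.

Variant letter := lx | ly.

Definition letter_bool u := if u is ly then true else false.
Definition bool_letter b := if b then ly else lx.
Fact letter_boolK : cancel letter_bool bool_letter. Proof. by case. Qed.
HB.instance Definition _ := Choice.copy letter (can_type letter_boolK).

Definition word : Type := {fmonom letter}.
HB.instance Definition _ := MonomialDef.on word.

Definition H : Type := {malg rat[word]}.
HB.instance Definition _ := GRing.Lalgebra.on H.

Definition mon (s : seq letter) : H := << FMonom s >>.
Definition X : H := mon [:: lx].
Definition Y : H := mon [:: ly].
Definition z (k : nat) : H := Y * X ^+ k.-1.

Lemma mon_nil : mon [::] = 1.
Proof. by rewrite /mon -[FMonom _]fmoneE. Qed.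

Lemma mon_cat s t : mon (s ++ t) = mon s * mon t.
Proof.
rewrite /mon -[FMonom _]/(FMonom (FMonom s ++ FMonom t)) -fmmulE.
by rewrite malgM_def fgmulUU mulr1.
Qed.

Lemma zE k : z k = mon (ly :: nseq k.-1 lx).
Proof.
rewrite /z -cat1s mon_cat; congr (_ * _).
by elim: k.-1 => [|m IHm]; rewrite ?expr0 ?mon_nil // exprS IHm -mon_cat.
Qed.

Lemma prod_zE (k : seq nat) :
  \prod_(a <- k) z a = mon (flatten [seq ly :: nseq a.-1 lx | a <- k]).
Proof.
elim: k => [|a k IHk]; first by rewrite big_nil mon_nil.
by rewrite big_cons IHk zE -mon_cat.
Qed.

(* shuffle_rev s t is the shuffle product of the words rev s and rev t: the
   recursion of the shuffle product removes last letters. *)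
Fixpoint shuffle_rev (s : seq letter) : seq letter -> H :=
  fix shuffle_rev_s (t : seq letter) : H :=
    match s, t with
    | [::], _ => mon (rev t)
    | _, [::] => mon (rev s)
    | u :: s', u' :: t' =>
        shuffle_rev s' t * mon [:: u] + shuffle_rev_s t' * mon [:: u']
    end.

Definition shuffle_word (v w : seq letter) : H := shuffle_rev (rev v) (rev w).

Definition shuffle (f g : H) : H :=
  linext (fun v : word => linext (fun w : word => shuffle_word v w) g) f.

Lemma shuffle_mon v w : shuffle (mon v) (mon w) = shuffle_word v w.
Proof. by rewrite /shuffle !linextU. Qed.

Lemma shuffle_word0l w : shuffle_word [::] w = mon w.
Proof. by rewrite /shuffle_word /=; case: (rev w) (revK w) => [|u t] /= ->. Qed.

Lemma shuffle_word0r w : shuffle_word w [::] = mon w.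
Proof. by rewrite /shuffle_word /=; case: (rev w) (revK w) => [|u t] /= ->. Qed.

Lemma shuffle_word_rcons w u w' u' :
  shuffle_word (rcons w u) (rcons w' u') =
    shuffle_word w (rcons w' u') * mon [:: u]
    + shuffle_word (rcons w u) w' * mon [:: u'].
Proof. by rewrite /shuffle_word !rev_rcons. Qed.

(* The index (k_1, ..., k_r) of a word z_{k_1} ... z_{k_r} (see zindexK). *)
Definition zindex (w : seq letter) : seq nat :=
  (foldr (fun u acc => if u is ly then (0%N, acc.1.+1 :: acc.2)
                       else (acc.1.+1, acc.2)) (0%N, [::]) w).2.

Definition iny (w : seq letter) : bool := if w is ly :: _ then true else false.

Definition ysh_z (k : nat) : H :=
  match k with
  | 0 => 0
  | 1 => - Y ^+ 2
  | 2 => 0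
  | k'.+3 => Y * X * shuffle Y (X ^+ k') * X
  end.

Definition ysh_index (k : seq nat) : H :=
  \sum_(l < size k) (\prod_(a <- take l k) z a) * ysh_z (nth 0%N k l)
                    * (\prod_(a <- drop l.+1 k) z a).

(* ysh is the map y ~sh _ of yH, where ~sh is the modified shuffle product with
   y ~sh z_k = ysh_z k; it is extended by 0 to the words not in yH. *)
Definition ysh : H -> H :=
  linext (fun w : word => if iny w then ysh_index (zindex w) else 0).
HB.instance Definition _ := GRing.Linear.copy ysh
  (linext (fun w : word => if iny w then ysh_index (zindex w) else 0 : H)).

Lemma zindexK (k : seq nat) : all (leq 1) k ->
  zindex (flatten [seq ly :: nseq a.-1 lx | a <- k]) = k.
Proof.
rewrite /zindex; set F := (fun u acc => _) => hk.
suff -> : foldr F (0%N, [::]) (flatten [seq ly :: nseq a.-1 lx | a <- k])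
          = (0%N, k) by [].
elim: k hk => //= -[|a] k IHk //= /IHk h; rewrite foldr_cat h.
suff -> : foldr F (0%N, k) (nseq a lx) = (a, k) by [].
by elim: a => //= a ->.
Qed.

Definition yH : {pred H} := fun f => all (fun w : word => iny w) (msupp f).

Lemma yHP f : reflect (forall w : word, w \in msupp f -> iny w) (f \in yH).
Proof. exact: allP. Qed.

Fact yH_submod_closed : submod_closed yH.
Proof.
split; first by apply/yHP => w; rewrite msupp0 in_fset0.
move=> c f g /yHP hf /yHP hg; apply/yHP => w /(fsubsetP (msuppD_le _ _)).
by rewrite in_fsetU => /orP[/(fsubsetP (msuppZ_le _ _))/hf | /hg].
Qed.
HB.instance Definition _ := GRing.isSubmodClosed.Build rat H yH yH_submod_closed.

Lemma yHMr f g : f \in yH -> f * g \in yH.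
Proof.
move=> /yHP hf; apply/yHP => w /msuppM_le[v [v' [/hf yv _ ->]]].
by rewrite fmM; case: v yv => -[|[]].
Qed.

Lemma YM_yH f : Y * f \in yH.
Proof.
by apply/yHMr/yHP => w; rewrite msuppU1 in_fset1 => /eqP ->.
Qed.

Lemma prod_z_yH (k : seq nat) : (0 < size k)%N -> \prod_(a <- k) z a \in yH.
Proof. by case: k => // a k _; rewrite big_cons /z -mulrA YM_yH. Qed.

Lemma ysh_z_yH k : ysh_z k \in yH.
Proof.
case: k => [|[|[|k]]] /=; rewrite ?rpred0 //; first by rewrite rpredN YM_yH.
by rewrite -!mulrA YM_yH.
Qed.

Lemma ysh_yH f : ysh f \in yH.
Proof.
rewrite /ysh /linext; apply: rpred_sum => w _; apply: rpredZ.
case: iny; last exact: rpred0.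
rewrite /ysh_index; apply: rpred_sum => l _; rewrite -mulrA.
case: l => [[|l] /= lt]; first by rewrite take0 big_nil mul1r yHMr ?ysh_z_yH.
by rewrite yHMr // prod_z_yH // size_take lt.
Qed.

Lemma ysh_prod_z (k : seq nat) : all (leq 1) k ->
  ysh (\prod_(a <- k) z a) = ysh_index k.
Proof.
move=> hk; rewrite prod_zE /ysh linextU /= zindexK //.
by case: k hk => //=; rewrite /ysh_index big_ord0.
Qed.

(* A tensor product of free modules is free on the product of the bases, so
   the direct sum of the H^{(x)d}, d >= 0, is the free module on the lists of
   words, that is, the free algebra on the set of words; its product is the
   tensor product. *)
Definition tensor : Type := {malg rat[{fmonom word}]}.
HB.instance Definition _ := GRing.Lalgebra.on tensor.

Definition tens1 : H -> tensor := linext (fun w : word => << fmu w >>).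
HB.instance Definition _ := GRing.Linear.copy tens1
  (linext (fun w : word => << fmu w >> : tensor)).

Definition tens (d : nat) (f : 'I_d -> H) : tensor := \prod_(i < d) tens1 (f i).

Definition cyc_basis (m : {fmonom word}) : bool :=
  (0 < size m)%N && all (fun w : word => iny w) m.

Definition Hcyc : {pred tensor} := fun f => all cyc_basis (msupp f).

Lemma tens_Hcyc d (f : 'I_d -> H) :
  (0 < d)%N -> (forall i, f i \in yH) -> tens f \in Hcyc.
Proof.
pose inyw (w : word) := iny w.
have h1 g m : g \in yH -> m \in msupp (tens1 g) ->
    exists2 w, inyw w & m = fmu w.
  move=> /yHP yg; apply: contraTP => hm; rewrite -mcoeff_eq0 /tens1 /linext.
  rewrite (raddf_sum (mcoeff m)) big_seq big1 // => w /yg yw /=.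
  rewrite mcoeffZ mcoeffU1; case: eqP => [e|_]; last by rewrite mulr0.
  by case: hm; exists w.
case: d f => // d f _ yf; apply/allP => m; rewrite /tens big_ord_recl.
move=> /msuppM_le[m1 [m2 [/(h1 _ _ (yf _))[w yw ->] hm2 ->]]].
rewrite /cyc_basis fmM fmU /= -/(inyw w) yw /=.
elim/big_rec: _ m2 hm2 => [m3|i g _ IHg m3].
  rewrite -mcoeff_neq0 mcoeff1.
  by have [->|_] := eqVneq m3 mone; rewrite ?fm1 ?eqxx.
move=> /msuppM_le[m1' [m2 [/(h1 _ _ (yf _))[w' yw' ->] /IHg hm2 ->]]].
by rewrite fmM fmU /= -/(inyw w') yw'.
Qed.

(* ordS is the cyclic successor, so the last condition reads
   n_{i,1} <= n_{i+1,r_{i+1}}, with i+1 = 1 when i = d. *)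
Definition Sp (p d : nat) (r : 'I_d -> nat)
    (n : {dffun forall i : 'I_d, {ffun 'I_(r i) -> 'I_p}}) : bool :=
  [&& [forall i, forall j, (0 < n i j)%N],
      [forall i, forall j : 'I_(r i), forall j' : 'I_(r i),
         (j < j')%N ==> (n i j < n i j')%N]
    & [forall i, forall j : 'I_(r i), forall j' : 'I_(r (ordS i)),
         (j == 0%N :> nat) && (j'.+1 == r (ordS i) :> nat)
           ==> (n i j <= n (ordS i) j')%N]].

Definition zeta_cyc (d : nat) (r : 'I_d -> nat)
    (k : forall i : 'I_d, 'I_(r i) -> nat) : A :=
  clA (fun p : primeN =>
    \sum_(n : {dffun forall i : 'I_d, {ffun 'I_(r i) -> 'I_(val p)}} | Sp n)
      \prod_(i < d) \prod_(j < r i) ((n i j)%:R : 'F_(val p)) ^- k i j).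

Definition Zcyc_basis (m : {fmonom word}) : A :=
  let k := [seq zindex w | w : word <- m] in
  if cyc_basis m then
    zeta_cyc (fun (i : 'I_(size k)) (j : 'I_(size (nth [::] k i))) =>
      nth 0%N (nth [::] k i) j)
  else 0.

(* Z is defined on Hcyc; Zcyc extends it by 0 on the other basis tensors. Its
   values on tensor products of z-words are given by Zcyc_tens. *)
Definition Zcyc : tensor -> A := linext Zcyc_basis.
HB.instance Definition _ := GRing.Linear.copy Zcyc (linext Zcyc_basis).

Lemma eq_zeta_cyc d1 d2 (r1 : 'I_d1 -> nat) (r2 : 'I_d2 -> nat)
    (k1 : forall i, 'I_(r1 i) -> nat) (k2 : forall i, 'I_(r2 i) -> nat) :
  d1 = d2 ->
  (forall (i1 : 'I_d1) (i2 : 'I_d2), i1 = i2 :> nat -> r1 i1 = r2 i2) ->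
  (forall (i1 : 'I_d1) (i2 : 'I_d2) (j1 : 'I_(r1 i1)) (j2 : 'I_(r2 i2)),
     i1 = i2 :> nat -> j1 = j2 :> nat ->
     k1 i1 j1 = k2 i2 j2) ->
  zeta_cyc k1 = zeta_cyc k2.
Proof.
move=> ed; subst d2 => er.
have ? : r1 = r2 by apply: functional_extensionality_dep => i; exact: er.
subst r2 => ek; congr zeta_cyc.
apply: functional_extensionality_dep => i.
by apply: functional_extensionality_dep => j; exact: ek.
Qed.

Lemma prod_ord_enum (R : pzSemiRingType) d (F : 'I_d -> R) :
  \prod_(i < d) F i = \prod_(i <- enum 'I_d) F i.
Proof. by rewrite [index_enum _]unlock -enumT. Qed.

Lemma tens_mon d (w : 'I_d -> seq letter) :
  tens (fun i => mon (w i))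
  = << (FMonom [seq FMonom (w i) : word | i <- enum 'I_d] : {fmonom word}) >>.
Proof.
rewrite /tens prod_ord_enum.
elim: (enum 'I_d) => [|i s IHs] /=; first by rewrite big_nil -[FMonom _]fmoneE.
rewrite big_cons IHs /tens1 linextU malgM_def fgmulUU mulr1.
by congr << _ >>; rewrite fmuE [LHS]fmmulE.
Qed.

Lemma Zcyc_tens d (r : 'I_d -> nat) (k : forall i : 'I_d, 'I_(r i) -> nat) :
  (0 < d)%N -> (forall i, 0 < r i)%N -> (forall i j, 0 < k i j)%N ->
  Zcyc (tens (fun i => \prod_(j < r i) z (k i j))) = zeta_cyc k.
Proof.
move=> d0 r0 k0.
pose ks i := [seq k i j | j <- enum 'I_(r i)].
have ksP i : all (leq 1) (ks i) by apply/allP => _ /mapP[j _ ->].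
have -> : (fun i => \prod_(j < r i) z (k i j)) =
          (fun i => mon (flatten [seq ly :: nseq a.-1 lx | a <- ks i])).
  apply: functional_extensionality_dep => i.
  by rewrite -prod_zE big_map prod_ord_enum.
rewrite tens_mon /Zcyc linextU /Zcyc_basis.
rewrite /cyc_basis /= size_map size_enum_ord d0 all_map.
have -> : all (preim (fun i => FMonom (flatten [seq ly :: nseq a.-1 lx | a <- ks i]) : word)
            (fun w : word => iny w)) (enum 'I_d).
  apply/allP => i _ /=.
  have: (0 < size (ks i))%N by rewrite size_map size_enum_ord.
  by case: (ks i).
rewrite /=.
set kk := map _ _.
have -> : kk = [seq ks i | i <- enum 'I_d].
  by rewrite /kk -map_comp; apply: eq_map => i /=; exact: zindexK.
apply: eq_zeta_cyc.
- by rewrite size_map size_enum_ord.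
- move=> i1 i2 ei; rewrite (nth_map i2) ?size_enum_ord ?ei ?ltn_ord //.
  by rewrite nth_ord_enum size_map size_enum_ord.
- move=> i1 i2 j1 j2 ei; move: (nat_of_ord j1) => m em.
  rewrite (nth_map i2) ?size_enum_ord ?ei ?ltn_ord // nth_ord_enum.
  by rewrite (nth_map j2) ?size_enum_ord ?em ?ltn_ord // nth_ord_enum.
Qed.

(* Main.v *)
Require Import Defs.
From HB Require Import structures.
From mathcomp Require Import all_boot all_order all_algebra.
From mathcomp Require Import boolp monalg ring zify.

(** Fix a prime p and index p x p matrices over F_p by residues, killing the
    index 0. With D_k = diag(n^-k), G = [u > v] and L = [u <= v], the
    p-component of zeta^cyc(k_1, ..., k_d) is the trace of V_1 ... V_d, where
    V_i = D_{k_{i,r_i}} G D_{k_{i,r_i - 1}} G ... G D_{k_{i,1}} L.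
    Since y ~sh z_k = sum_{a+b=k+1} z_a z_b - z_1 z_k - z_k z_1, the difference
    of the two sides replaces one factor D_k at a time by
    sum_{a+b=k+1} D_b G D_a - D_k G D_1 - D_1 G D_k - 2 D_{k+1}.
    By partial fractions the first sum is the commutator [N, D_k], where
    N = [u > v]/(u - v); with h = diag(1 + 1/2 + ... + 1/n), everything is
    P D_k - D_k Q for P = N - D_1 G - 2h and Q = N + G D_1 - 2(h - D_1).
    Harmonic sums give G P = Q G and L P = Q L, so the replacements telescope
    inside each V_i to P V_i - V_i P, and then over i to the trace of the
    commutator of P with V_1 ... V_d, which vanishes. *)

Set Implicit Arguments.
Unset Strict Implicit.
Unset Printing Implicit Defensive.

Import GRing.Theory.
Local Open Scope ring_scope.

(** * Replacing one entry of a word or one factor of a noncommutative product *)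

Definition splice (k : seq nat) l (t : seq nat) := take l k ++ t ++ drop l.+1 k.

Lemma splice_neq_nil k l t : t != [::] -> splice k l t != [::].
Proof. by rewrite /splice; case: (take l k) => //; case: t. Qed.

Lemma all_splice k l t :
  all (leq 1) k -> all (leq 1) t -> all (leq 1) (splice k l t).
Proof.
move=> /allP k0 t0; rewrite !all_cat t0 /=.
by apply/andP; split; apply/allP => a /mem_subseq ha; apply/k0/ha;
  [exact: take_subseq | exact: drop_subseq].
Qed.

(* The formal effect of y ~sh _ on a letter z_n, minus twice that of z_{n+1}:
   see ysh_zE. *)
Definition ysh_defect (V : zmodType) (f : seq nat -> V) (n : nat) : V :=
  \sum_(a < n) f [:: a.+1; (n - a)%N] - f [:: 1%N; n] - f [:: n; 1%N]
  - f [:: n.+1] *+ 2.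

Lemma raddf_ysh_defect (V U : zmodType) (g : {additive V -> U}) f n :
  g (ysh_defect f n) = ysh_defect (g \o f) n.
Proof. by rewrite /ysh_defect !raddfB raddfMn raddf_sum. Qed.

Lemma eq_ysh_defect (V : zmodType) (f g : seq nat -> V) n :
    (forall t, t != [::] -> (0 < n)%N ==> all (leq 1) t -> f t = g t) ->
  ysh_defect f n = ysh_defect g n.
Proof.
move=> fg; rewrite /ysh_defect !fg ?implybT //= ?andbT ?implybb //.
by congr (_ - _ - _ - _); apply: eq_bigr => a _;
  rewrite fg //= subn_gt0 ltn_ord implybT.
Qed.

(** The factors before and after [i] supply [a] and [b]; so a product is additive in each single
    factor, and defects pass through it. *)
Lemma prod_update (R : pzRingType) d (i : 'I_d) (v : 'I_d -> R) :
  exists a b, forall h, \prod_(j < d) (if j == i then h else v j) = a * h * b.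
Proof.
have [s1 [s2 es]] : exists s1 s2, enum 'I_d = s1 ++ i :: s2.
  by have := mem_enum 'I_d i; case/splitPr=> s1 s2; exists s1, s2.
exists (\prod_(j <- s1) v j), (\prod_(j <- s2) v j) => h.
have := enum_uniq 'I_d; rewrite prod_ord_enum es.
rewrite cat_uniq /= negb_or => /and3P[_ /andP[is1 _] /andP[is2 _]].
rewrite big_cat /= big_cons eqxx mulrA; congr (_ * _ * _);
  by apply: eq_big_seq => j; case: eqP => // ->;
     rewrite ?(negPf is1) ?(negPf is2).
Qed.

(** The Leibniz rule for the commutator with [x]: contributions of neighbouring positions cancel. *)
Lemma sum_prod_update_comm (R : pzRingType) (I : eqType) (s : seq I) (x : R)
    (v : I -> R) : uniq s ->
  \sum_(i <- s) \prod_(j <- s) (if j == i then x * v j - v j * x else v j)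
  = x * \prod_(j <- s) v j - \prod_(j <- s) v j * x.
Proof.
pose g i j := if j == i then x * v j - v j * x else v j.
elim: s => [_|a s IHs /= /andP[as_ us]].
  by rewrite !big_nil mulr1 mul1r subrr.
rewrite !big_cons eqxx -/(g a).
have -> : \prod_(j <- s) g a j = \prod_(j <- s) v j.
  rewrite /g; by apply: eq_big_seq => j js; case: eqP as_ js => // -> /negP.
have -> : \sum_(i <- s) \prod_(j <- a :: s) g i j
        = v a * \sum_(i <- s) \prod_(j <- s) g i j.
  rewrite mulr_sumr; apply: eq_big_seq => i is_; rewrite big_cons /g.
  by case: eqP as_ is_ => // -> /negP.
by rewrite IHs // mulrBl mulrBr !mulrA addrA subrK.
Qed.

(** * Transfer matrices in characteristic p and their harmonic-sum relations *)

Section TransferMatrices.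
Variables (F : fieldType) (p : nat).
Hypothesis charFp : p \in [pchar F].

(* Indices are restricted to 0 < u: D_k kills the index 0 even for k = 0. *)
Definition powmx (k : nat) : 'M[F]_p :=
  diag_mx (\row_i if (0 < i)%N then i%:R ^- k else 0).
Definition gtmx : 'M[F]_p := \matrix_(u, v) if (0 < v < u)%N then 1 else 0.
Definition lemx : 'M[F]_p := \matrix_(u, v) if (0 < u <= v)%N then 1 else 0.
Definition cauchymx : 'M[F]_p :=
  \matrix_(u, v) if (0 < v < u)%N then (u - v)%:R^-1 else 0.

(* The term i = 0 is 0^-1 = 0. *)
Definition harm (n : nat) : F := \sum_(i < n.+1) i%:R^-1.
Definition harmmx : 'M[F]_p := diag_mx (\row_i if (0 < i)%N then harm i else 0).

(* lmx and rmx are the P and Q of the header, cauchymx is N. *)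
Definition lmx : 'M[F]_p := cauchymx - powmx 1 * gtmx - harmmx *+ 2.
Definition rmx : 'M[F]_p := cauchymx + gtmx * powmx 1 - (harmmx - powmx 1) *+ 2.

Lemma harm0 : harm 0 = 0.
Proof. by rewrite /harm big_ord1 invr0. Qed.

Lemma harmS n : harm n.+1 = harm n + n.+1%:R^-1.
Proof. by rewrite /harm big_ord_recr. Qed.

Lemma harm_pred n : harm n.-1 = harm n - n%:R^-1.
Proof. by case: n => [|n]; rewrite ?harm0 ?invr0 ?subr0 // harmS addrK. Qed.

Lemma natFp_neq0 n : (0 < n < p)%N -> n%:R != 0 :> F.
Proof.
by case/andP=> n0 np; rewrite -(dvdn_pcharf charFp) gtnNdvd.
Qed.

(** Modulo p one has 1/(p - i) = -1/i, so going down from p - 1 mirrors going up from 0. The value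
    [harm p.-1] stays symbolic, being nonzero for p = 2; it cancels in [le_lmx]. *)
Lemma harm_compl v : (v < p)%N -> harm (p.-1 - v) = harm v + harm p.-1.
Proof.
elim: v => [|v IHv] vp; first by rewrite subn0 harm0 add0r.
rewrite subnS harm_pred IHv 1?ltnW // harmS.
have -> : (p.-1 - v = p - v.+1)%N by lia.
by rewrite natrB ?(ltnW vp) // (pcharf0 charFp) sub0r invrN opprK addrAC.
Qed.

(** The entries below are sums over a middle index m in an interval, with differences of a harmonic
    sum [g] as terms. An empty interval covers the entries that vanish. *)
Lemma mulmx_telescope (A B : 'M[F]_p) (g : nat -> F) (u v : 'I_p) a b :
    (a <= b <= p)%N ->
    (forall m : 'I_p, (a <= m < b)%N -> A u m * B m v = g m.+1 - g m) ->
    (forall m : 'I_p, ~~ (a <= m < b)%N -> A u m * B m v = 0) ->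
  (A * B) u v = g b - g a.
Proof.
case/andP=> ab bp hin hout; rewrite -(telescope_sumr g ab) -mulmxE mxE.
rewrite (big_nat_widenl _ 0) // (big_nat_widen _ _ _ _ _ bp) big_mkord.
rewrite [RHS]big_mkcond; apply: eq_bigr => m _ /=.
by case: ifPn => [/hin | /hout].
Qed.

Lemma mul_powmx k A (u v : 'I_p) :
  (powmx k * A) u v = if (0 < u)%N then u%:R ^- k * A u v else 0.
Proof. by rewrite -mulmxE mul_diag_mx !mxE; case: ifP; rewrite ?mul0r. Qed.

Lemma mulmx_powmx k A (u v : 'I_p) :
  (A * powmx k) u v = if (0 < v)%N then A u v * v%:R ^- k else 0.
Proof. by rewrite -mulmxE mul_mx_diag !mxE; case: ifP; rewrite ?mulr0. Qed.

Lemma mul_harmmx A (u v : 'I_p) :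
  (harmmx * A) u v = if (0 < u)%N then harm u * A u v else 0.
Proof. by rewrite -mulmxE mul_diag_mx !mxE; case: ifP; rewrite ?mul0r. Qed.

Lemma mulmx_harmmx A (u v : 'I_p) :
  (A * harmmx) u v = if (0 < v)%N then A u v * harm v else 0.
Proof. by rewrite -mulmxE mul_mx_diag !mxE; case: ifP; rewrite ?mulr0. Qed.

Lemma powmxM k l : powmx k * powmx l = powmx (k + l).
Proof.
apply/matrixP=> u v; rewrite mul_powmx !mxE.
case: eqP => _; rewrite ?mulr0n ?mulr0 ?if_same //.
by case: ifP => u0; rewrite ?u0 !mulr1n // exprD invfM.
Qed.

Lemma powmx_harmC k : powmx k * harmmx = harmmx * powmx k.
Proof. by rewrite -!mulmxE diag_mxC. Qed.

Ltac outside :=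
  by move=> m; have := ltn_ord m; rewrite ?mul_powmx !mxE => mp hm;
  do 3?[case: ifP => ?]; rewrite ?mulr0 ?mul0r //; lia.
Ltac inside :=
  move=> m hm; rewrite ?mul_powmx !mxE !ifT ?mul1r ?mulr1; [|lia..].

Lemma gt_cauchyE (u v : 'I_p) :
  (gtmx * cauchymx) u v = if (0 < v < u)%N then harm (u - v.+1) else 0.
Proof.
have up := ltn_ord u; case: ifP => uv.
  rewrite (@mulmx_telescope _ _ (fun m => harm (m.-1 - v)) _ _ v.+1 u).
  - by rewrite subnn harm0 subr0; congr harm; lia.
  - lia.
  - inside; have -> : (m - v = (m.-1 - v).+1)%N by lia.
    by rewrite harmS addrAC subrr add0r.
  - outside.
rewrite (@mulmx_telescope _ _ (fun=> 0) _ _ 0 0) ?subr0 //.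
outside.
Qed.

(** The sum of 1/(u - m) over v < m < u agrees with that of 1/(m - v), so [gtmx] and [cauchymx]
    commute. *)
Lemma cauchy_gtE (u v : 'I_p) :
  (cauchymx * gtmx) u v = if (0 < v < u)%N then harm (u - v.+1) else 0.
Proof.
have up := ltn_ord u; case: ifP => uv.
  rewrite (@mulmx_telescope _ _ (fun m => - harm (u - m)) _ _ v.+1 u).
  - by rewrite subnn harm0 opprK oppr0 add0r.
  - lia.
  - inside; have -> : (u - m = (u - m.+1).+1)%N by lia.
    by rewrite harmS opprK addrA addNr add0r.
  - outside.
rewrite (@mulmx_telescope _ _ (fun=> 0) _ _ 0 0) ?subr0 //.
outside.
Qed.

Lemma gt_pow1_gtE (u v : 'I_p) :
  (gtmx * (powmx 1 * gtmx)) u v =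
  if (0 < v < u)%N then harm u.-1 - harm v else 0.
Proof.
have up := ltn_ord u; case: ifP => uv.
  rewrite (@mulmx_telescope _ _ (fun m => harm m.-1) _ _ v.+1 u) //.
  - lia.
  - by inside; rewrite (harm_pred m) opprB addrCA subrr addr0.
  - outside.
rewrite (@mulmx_telescope _ _ (fun=> 0) _ _ 0 0) ?subr0 //.
outside.
Qed.

(** The sum of 1/(m - v) over max(u, v+1) <= m < p involves H_(p-1-v), which [harm_compl] reflects
    to H_v. *)
Lemma le_cauchyE (u v : 'I_p) :
  (lemx * cauchymx) u v =
  if (0 < u)%N && (0 < v)%N then harm v + harm p.-1 - harm (u.-1 - v) else 0.
Proof.
have up := ltn_ord u; have vp := ltn_ord v; case: ifP => uv.
  rewrite (@mulmx_telescope _ _ (fun m => harm (m.-1 - v)) _ _ (maxn u v.+1) p).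
  - by rewrite harm_compl //; congr (_ - harm _); lia.
  - lia.
  - inside; have -> : (m - v = (m.-1 - v).+1)%N by lia.
    by rewrite harmS addrAC subrr add0r.
  - outside.
rewrite (@mulmx_telescope _ _ (fun=> 0) _ _ 0 0) ?subr0 //.
outside.
Qed.

Lemma cauchy_leE (u v : 'I_p) :
  (cauchymx * lemx) u v =
  if (0 < u)%N && (0 < v)%N then harm u.-1 - harm (u.-1 - v) else 0.
Proof.
have up := ltn_ord u; have vp := ltn_ord v; case: ifP => uv.
  rewrite (@mulmx_telescope _ _ (fun m => - harm (u - m)) _ _ 1 (minn u v.+1)).
  - by rewrite opprK addrC subn1; congr (_ - harm _); lia.
  - lia.
  - inside; have -> : (u - m = (u - m.+1).+1)%N by lia.
    by rewrite harmS opprK addrA addNr add0r.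
  - outside.
rewrite (@mulmx_telescope _ _ (fun=> 0) _ _ 0 0) ?subr0 //.
outside.
Qed.

Lemma le_pow1_gtE (u v : 'I_p) :
  (lemx * (powmx 1 * gtmx)) u v =
  if (0 < u)%N && (0 < v)%N then harm p.-1 - harm (maxn u v.+1).-1 else 0.
Proof.
have up := ltn_ord u; have vp := ltn_ord v; case: ifP => uv.
  rewrite (@mulmx_telescope _ _ (fun m => harm m.-1) _ _ (maxn u v.+1) p) //.
  - lia.
  - by inside; rewrite (harm_pred m) opprB addrCA subrr addr0.
  - outside.
rewrite (@mulmx_telescope _ _ (fun=> 0) _ _ 0 0) ?subr0 //.
outside.
Qed.

Lemma gt_pow1_leE (u v : 'I_p) :
  (gtmx * (powmx 1 * lemx)) u v =
  if (0 < u)%N && (0 < v)%N then harm (minn u v.+1).-1 else 0.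
Proof.
have up := ltn_ord u; have vp := ltn_ord v; case: ifP => uv.
  rewrite (@mulmx_telescope _ _ (fun m => harm m.-1) _ _ 1 (minn u v.+1)) //.
  - by rewrite harm0 subr0.
  - lia.
  - by inside; rewrite (harm_pred m) opprB addrCA subrr addr0.
  - outside.
rewrite (@mulmx_telescope _ _ (fun=> 0) _ _ 0 0) ?subr0 //.
outside.
Qed.

Lemma mulmx_lmxE (R : 'M[F]_p) (u v : 'I_p) :
  (R * lmx) u v = (R * cauchymx) u v - (R * (powmx 1 * gtmx)) u v
                  - (R * harmmx) u v *+ 2.
Proof.
rewrite /lmx !mulrBr mulrnAr.
by move: (R * _) (R * _) (R * _) => ? ? ?; rewrite !mxE.
Qed.

Lemma mul_rmxE (R : 'M[F]_p) (u v : 'I_p) :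
  (rmx * R) u v = (cauchymx * R) u v + (gtmx * (powmx 1 * R)) u v
                  - ((harmmx * R) u v - (powmx 1 * R) u v) *+ 2.
Proof.
rewrite /rmx mulrBl mulrDl mulrnAl mulrBl -mulrA.
by move: (_ * _) (_ * _) (_ * _) (_ * _) => ? ? ? ?; rewrite !mxE.
Qed.

(** For 0 < v < u both entries are H_(u-v-1) - H_(u-1) - H_v. *)
Lemma gt_lmx : gtmx * lmx = rmx * gtmx.
Proof.
apply/matrixP=> u v; rewrite mulmx_lmxE mul_rmxE gt_cauchyE cauchy_gtE.
rewrite gt_pow1_gtE mulmx_harmmx mul_harmmx mul_powmx !mxE.
case: ifP => uv; last by rewrite !mulr0 mul0r !if_same; ring.
by rewrite !ifT ?harm_pred; [ring | lia..].
Qed.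

(** For u, v > 0 both entries vanish if u <= v, and equal H_v + H_(u-1) - H_(u-1-v) if v < u;
    H_(p-1) drops out. *)
Lemma le_lmx : lemx * lmx = rmx * lemx.
Proof.
apply/matrixP=> u v; rewrite mulmx_lmxE mul_rmxE le_cauchyE cauchy_leE.
rewrite le_pow1_gtE gt_pow1_leE mulmx_harmmx mul_harmmx mul_powmx !mxE.
have [v0|v0] := posnP v.
  have -> : (0 < u <= v)%N = false by lia.
  by rewrite andbF; case: ifP => _; ring.
have [u0|u0] := posnP u; first by rewrite /=; ring.
have [uv|vu] /= := leqP u v.
  have -> : (maxn u v.+1 = v.+1)%N by lia.
  have -> : (minn u v.+1 = u)%N by lia.
  by rewrite /= (harm_pred u) expr1; ring.
have -> : (maxn u v.+1 = u)%N by lia.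
have -> : (minn u v.+1 = v.+1)%N by lia.
by rewrite /= (harm_pred u) expr1; ring.
Qed.

(** For 0 < v < u the number u - v is invertible modulo p. Multiplying the entry by it turns the
    terms into differences of consecutive values of u^(a-k) v^(-a), and the sum telescopes to v^(-k)
    - u^(-k). *)
Lemma sum_powmx_gt_powmx k :
  \sum_(a < k) powmx (k - a) * gtmx * powmx a.+1 =
  cauchymx * powmx k - powmx k * cauchymx.
Proof.
apply/matrixP=> u v; rewrite summxE.
under eq_bigr do rewrite mulmx_powmx mul_powmx mxE.
transitivity ((cauchymx * powmx k) u v - (powmx k * cauchymx) u v); last first.
  by move: (_ * _) (_ * _) => ? ?; rewrite !mxE.
rewrite mulmx_powmx mul_powmx mxE.
have up := ltn_ord u; have vp := ltn_ord v.
case: ifP => uv; last first.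
  rewrite mulr0 mul0r !if_same subrr big1 // => a _.
  by rewrite mulr0 if_same mul0r if_same.
have [-> ->] : (0 < u)%N /\ (0 < v)%N by lia.
have u0 : u%:R != 0 :> F by apply: natFp_neq0; lia.
have v0 : v%:R != 0 :> F by apply: natFp_neq0; lia.
have uv0 : (u - v)%:R != 0 :> F by apply: natFp_neq0; lia.
pose f a := u%:R ^- (k - a) * v%:R ^- a : F.
apply: (mulfI uv0); transitivity (\sum_(0 <= a < k) (f a.+1 - f a)).
  rewrite mulr_sumr big_mkord; apply: eq_bigr => a _; rewrite /f.
  have -> : (k - a = (k - a.+1).+1)%N by have := ltn_ord a; lia.
  rewrite natrB ?(ltnW (proj2 (andP uv))) // mulr1 !exprS; field.
  by rewrite u0 v0 !expf_neq0.
rewrite telescope_sumr // /f subnn subn0 !expr0 invr1 mul1r mulr1.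
by field; rewrite uv0 !expf_neq0.
Qed.

(* The order is reversed, so that the block i of a cyclic index is followed by
   its first entry n_{i,1}, which is compared by L with the last entry of the
   block i+1. *)
Fixpoint wordmx (k : seq nat) : 'M[F]_p :=
  if k is a :: k' then
    if k' is [::] then powmx a else wordmx k' * gtmx * powmx a
  else 1.

Lemma wordmx_cons a k : k != [::] ->
  wordmx (a :: k) = wordmx k * gtmx * powmx a.
Proof. by case: k. Qed.

Lemma wordmx_cat s t : s != [::] -> t != [::] ->
  wordmx (s ++ t) = wordmx t * gtmx * wordmx s.
Proof.
elim: s => // a [_ _ t0|b s IHs _ t0]; first by rewrite cat1s wordmx_cons.
by rewrite cat_cons wordmx_cons // IHs // (@wordmx_cons a (b :: s)) // !mulrA.
Qed.

(** The harmonic parts of [lmx] and [rmx] cancel because diagonal matrices commute, and the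
    [powmx 1] in the doubled term of [rmx] produces -2 D_(n+1). *)
Lemma wordmx_defect1 n : ysh_defect wordmx n = lmx * powmx n - powmx n * rmx.
Proof.
rewrite /ysh_defect /= sum_powmx_gt_powmx /lmx /rmx.
rewrite !mulrBl !mulrBr mulrDr !(mulrnAl, mulrnAr) mulrBr !powmxM powmx_harmC.
rewrite -!mulrA addn1 mulrnBl !opprB.
move: (cauchymx * _) (powmx n * _) (powmx n * _) (powmx 1 * _) (harmmx * _).
by move: (powmx _) => ? ? ? ? ? ?; apply/matrixP=> u v; rewrite !mxE; ring.
Qed.

(** With W the matrix of the tail, changing the head gives W G (P D_a - D_a Q), changing the tail
    gives (P W - W Q) G D_a, and the inner terms cancel by G P = Q G. *)
Lemma wordmx_defect k : k != [::] ->
  \sum_(l < size k) ysh_defect (wordmx \o splice k l) (nth 0%N k l)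
  = lmx * wordmx k - wordmx k * rmx.
Proof.
elim: k => // a k IHk _; rewrite big_ord_recl.
have [->|k0] := eqVneq k [::].
  rewrite big_ord0 addr0 -wordmx_defect1; apply: eq_ysh_defect => t _ _ /=.
  by rewrite /splice /= cats0.
pose g1 : {additive 'M[F]_p -> 'M[F]_p} := (wordmx k * gtmx) \*o idfun.
pose g2 : {additive 'M[F]_p -> 'M[F]_p} := (gtmx * powmx a) \o* idfun.
rewrite [X in X + _](_ : _ = g1 (lmx * powmx a - powmx a * rmx)); last first.
  rewrite -wordmx_defect1 raddf_ysh_defect; apply: eq_ysh_defect => t t0 _.
  by rewrite /= /splice /= drop0 wordmx_cat.
rewrite [X in _ + X](_ : _ = g2 (lmx * wordmx k - wordmx k * rmx)); last first.
  rewrite -IHk // raddf_sum; apply: eq_bigr => l _.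
  rewrite raddf_ysh_defect; apply: eq_ysh_defect => t t0 _.
  have st0 := splice_neq_nil k l t0.
  by rewrite -[LHS]/(wordmx (a :: splice k l t)) wordmx_cons // -mulrA.
rewrite wordmx_cons // /g1 /g2 /=; move: (lmx) (rmx) gt_lmx => x y gxy.
rewrite mulrBr !mulrBl !mulrA -[_ * gtmx * x]mulrA gxy.
by rewrite !mulrA addrC addrA subrK.
Qed.

Lemma trace_ysh_defect d (ks : 'I_d -> seq nat) : (forall i, ks i != [::]) ->
  \sum_(i < d) \sum_(l < size (ks i))
    ysh_defect (fun t => \tr (\prod_(j < d)
      (wordmx (if j == i then splice (ks i) l t else ks j) * lemx)))
      (nth 0%N (ks i) l) = 0.
Proof.
move=> ks0; pose v i := wordmx (ks i) * lemx.
(* By Q L = L P, the defects in block i add up to the commutator of P with V_i. *)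
transitivity (\tr (\sum_(i < d) \prod_(j < d)
                (if j == i then lmx * v j - v j * lmx else v j))).
  rewrite raddf_sum; apply: eq_bigr => i _.
  have [a [b ab]] := prod_update i v.
  pose g : {additive 'M[F]_p -> F} :=
    @mxtrace F p \o (a \*o ((lemx * b) \o* idfun)).
  transitivity (g (lmx * wordmx (ks i) - wordmx (ks i) * rmx)).
    rewrite -wordmx_defect // raddf_sum; apply: eq_bigr => l _.
    rewrite raddf_ysh_defect; apply: eq_ysh_defect => t _ _ /=.
    rewrite mulrA mulrA -[a * _ * _]mulrA -ab; congr (\tr _).
    by apply: eq_bigr => j _; case: eqP.
  rewrite /g /= 2!mulrA -[a * _ * _]mulrA mulrBl.
  rewrite -!(mulrA (wordmx _)) -(mulrA lmx).
  rewrite -le_lmx mulrA -/(v i) -mulrA -/(v i) -ab.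
  by congr (\tr _); apply: eq_bigr => j _; case: eqP => // ->; rewrite mulrA.
(* By the Leibniz rule the sum is itself a commutator with P, so its trace is 0. *)
under eq_bigr do rewrite prod_ord_enum.
rewrite [index_enum _]unlock -enumT sum_prod_update_comm ?enum_uniq //.
by apply/eqP; rewrite raddfB subr_eq0; apply/eqP/mxtrace_mulC.
Qed.

End TransferMatrices.

(** * Sums over chains and cyclic sums as matrix entries and traces *)

Lemma prod_sum_dffun (R : comPzRingType) (I : finType) (T : I -> finType)
    (P : forall i, pred (T i)) (f : forall i, T i -> R) :
  \prod_i \sum_(t | P i t) f i t =
  \sum_(n : {dffun forall i, T i} | [forall i, P i (n i)]) \prod_i f i (n i).
Proof.
(* The constraints become zero values of [g], so that unrestricted distributivity applies. *)
pose g i := [ffun t : T i => if P i t then f i t else 0].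
transitivity (\sum_(n : fprod T) \prod_i g i (n i)).
  transitivity (\prod_i \sum_(j in tagged_with T i) untag 0 (g i) j);
    last by rewrite bigA_distr_big_dep big_fprod.
  apply: eq_bigr => i _; rewrite -(big_tag (fun i => g i)) big_mkcond.
  by apply: eq_bigr => t _; rewrite ffunE.
rewrite (reindex (@fprod_of_dffun _ T)); last exact/onW_bij/fprod_of_dffun_bij.
rewrite [RHS]big_mkcond; apply: eq_bigr => n _.
under eq_bigr do rewrite fprodE ffunE.
case: ifPn => [/forallP Pn | /forallPn[i /negPf Pni]].
  by apply: eq_bigr => i _; rewrite Pn.
by rewrite (bigD1 i) //= Pni mul0r.
Qed.

Section FfunCons.
Variables (T : finType) (n : nat).
Definition ffcons (x : T) (t : {ffun 'I_n -> T}) : {ffun 'I_n.+1 -> T} :=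
  [ffun i => oapp t x (unlift ord0 i)].

Lemma ffcons0 x t : ffcons x t ord0 = x.
Proof. by rewrite ffunE unlift_none. Qed.

Lemma ffconsS x t i : ffcons x t (lift ord0 i) = t i.
Proof. by rewrite ffunE liftK. Qed.

Lemma sum_ffcons (V : nmodType) (f : {ffun 'I_n.+1 -> T} -> V) :
  \sum_t f t = \sum_x \sum_t f (ffcons x t).
Proof.
rewrite pair_big /= (reindex (fun c => ffcons c.1 c.2)) //.
pose uncons (t : {ffun 'I_n.+1 -> T}) := (t ord0, [ffun i => t (lift ord0 i)]).
exists uncons => [[x t] _|t _]; rewrite /uncons /=.
  by rewrite ffcons0; congr pair; apply/ffunP=> i; rewrite ffunE ffconsS.
apply/ffunP=> i; rewrite ffunE; case: unliftP => [j|] -> //=.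
by rewrite ffunE.
Qed.
End FfunCons.

Definition increasing p n (t : {ffun 'I_n -> 'I_p}) : bool :=
  [forall j, (0 < t j)%N] &&
  [forall j : 'I_n, forall j' : 'I_n, (j < j')%N ==> (t j < t j')%N].

Lemma increasingP p n (t : {ffun 'I_n -> 'I_p}) :
  reflect ((forall j, 0 < t j)%N /\
           (forall j j' : 'I_n, j < j' -> t j < t j')%N)
          (increasing t).
Proof.
apply: (iffP andP) => -[]; first by move=> /forallP h1 /'forall_forallP h2;
  split=> // j j'; exact: (implyP (h2 j j')).
move=> h1 h2; split; first exact/forallP.
by apply/'forall_forallP => j j'; apply/implyP/h2.
Qed.

Lemma increasing_ffcons p n (x : 'I_p) (t : {ffun 'I_n.+1 -> 'I_p}) :
  increasing (ffcons x t) = increasing t && (0 < x < t ord0)%N.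
Proof.
apply/increasingP/andP => [[h1 h2]|[/increasingP[h1 h2] /andP[x0 xt]]].
  split.
    apply/increasingP; split=> [j|j j' jj'].
      by have := h1 (lift ord0 j); rewrite ffconsS.
    by have := h2 (lift ord0 j) (lift ord0 j'); rewrite !ffconsS; exact.
  have := h2 ord0 (lift ord0 ord0) isT; rewrite ffcons0 ffconsS => ->.
  by have := h1 ord0; rewrite ffcons0 andbT.
split=> [j|j j'].
  by case: (unliftP ord0 j) => [i|] ->; rewrite ?ffconsS ?ffcons0.
case: (unliftP ord0 j) => [i|] ->; case: (unliftP ord0 j') => [i'|] -> //;
  rewrite ?ffconsS ?ffcons0; first exact: h2.
move=> _; apply: (leq_trans xt).
by have [->|i0] := eqVneq i' ord0; last by apply/ltnW/h2; rewrite lt0n.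
Qed.

Lemma increasing1 p (t : {ffun 'I_1 -> 'I_p}) : increasing t = (0 < t ord0)%N.
Proof.
apply/increasingP/idP => [[] // | t0].
by split=> [j|j j']; rewrite !ord1.
Qed.

Section Chains.
Variables (F : fieldType) (p : nat).

(** The last entry of the chain is the row index and the first is paired with [R], in line with the
    reversed order of [wordmx]. Summing over a new first entry below the old one replaces [R] by G
    D_a R. *)
Lemma sum_increasing_cons a s (R : 'M[F]_p) (u v : 'I_p) :
  \sum_(t : {ffun 'I_(size s).+1 -> 'I_p} | increasing t && (t ord_max == u))
    (\prod_j (t j)%:R ^- nth 0%N (a :: s) j) * R (t ord0) v
  = (wordmx F p (a :: s) * R) u v.
Proof.
elim: s a R => [|b s IHs] a R.
  rewrite big_mkcond sum_ffcons /= mul_powmx.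
  under eq_bigr => x _.
    under eq_bigr do rewrite increasing1 big_ord1 [ord_max]ord1 ffcons0.
    rewrite sumr_const card_ffun !card_ord expn0 mulr1n.
    over.
  rewrite -big_mkcond /=; under eq_bigl do rewrite andbC.
  by rewrite big_mkcondr big_pred1_eq.
rewrite wordmx_cons // -!mulrA -IHs big_mkcond sum_ffcons exchange_big /=.
rewrite [RHS]big_mkcond; apply: eq_bigr => t _.
have -> : ord_max = lift ord0 ord_max :> 'I_(size s).+2 by exact: val_inj.
under eq_bigr do rewrite increasing_ffcons ffconsS andbAC.
case: ifP => ht; last by rewrite big1.
under eq_bigr do rewrite big_ord_recl !ffcons0 /=.
rewrite -mulmxE mxE mulr_sumr mulmxE; apply: eq_bigr => x _.
rewrite mul_powmx mxE /=; case: ifP => xt; last by rewrite mul0r mulr0.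
rewrite (proj1 (andP xt)) mul1r mulrAC mulrC; congr (_ * _).
by apply: eq_bigr => j _; rewrite ffconsS.
Qed.

Lemma sum_increasing s (R : 'M[F]_p) (u v : 'I_p) (j0 j1 : 'I_(size s)) :
    j0 = 0%N :> nat -> j1.+1 = size s ->
  \sum_(t : {ffun 'I_(size s) -> 'I_p} | increasing t && (t j1 == u))
    (\prod_j (t j)%:R ^- nth 0%N s j) * R (t j0) v
  = (wordmx F p s * R) u v.
Proof.
case: s j0 j1 => [[]//|a s] j0 j1 e0 e1; rewrite -sum_increasing_cons.
have -> : j0 = ord0 by exact: val_inj.
by have -> : j1 = ord_max by apply: val_inj; case: e1.
Qed.

(* Reads the sequence e_1, ..., e_{n-1}, y, that is, e shifted by one. *)
Definition nextv n (T : finType) (e : {ffun 'I_n -> T}) (y : T) (i : nat) : T :=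
  oapp e y (insub i.+1).

Lemma nextv_lt n (T : finType) (e : {ffun 'I_n -> T}) y i (lti : (i.+1 < n)%N) :
  nextv e y i = e (Ordinal lti).
Proof. by rewrite /nextv insubT. Qed.

Lemma nextv_ge n (T : finType) (e : {ffun 'I_n -> T}) y i :
  (n <= i.+1)%N -> nextv e y i = y.
Proof. by rewrite leqNgt => /negPf ni; rewrite /nextv insubF. Qed.

Lemma prodmx_path n (Q : 'I_n.+1 -> 'M[F]_p) (x y : 'I_p) :
  (\prod_i Q i) x y =
  \sum_(e : {ffun 'I_n.+1 -> 'I_p} | e ord0 == x)
    \prod_i Q i (e i) (nextv e y i).
Proof.
elim: n Q x => [|n IHn] Q x.
  rewrite big_ord1 big_mkcond sum_ffcons.
  under eq_bigr => z _.
    under eq_bigr do rewrite ffcons0 big_ord1 ffcons0 nextv_ge //.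
    rewrite sumr_const card_ffun !card_ord expn0 mulr1n.
    over.
  by rewrite -big_mkcond big_pred1_eq.
rewrite big_ord_recl -mulmxE mxE [RHS]big_mkcond [RHS]sum_ffcons.
under [RHS]eq_bigr do under eq_bigr do rewrite ffcons0.
rewrite [RHS](bigD1 x) //= [X in _ + X]big1 ?addr0; last first.
  by move=> z /negPf zx; apply: big1 => e _; rewrite zx.
rewrite eqxx; under eq_bigr do rewrite IHn mulr_sumr.
rewrite (exchange_big_dep predT) //=; apply: eq_bigr => e _.
rewrite (big_pred1 (e ord0)) => [|z]; last by rewrite eq_sym.
rewrite [RHS]big_ord_recl ffcons0 nextv_lt; congr (Q _ _ _ * _).
  by rewrite -(ffconsS x e); congr (ffcons x e _); exact: val_inj.
apply: eq_bigr => i _; rewrite ffconsS; congr (Q _ _ _).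
have [hi|hi] := ltnP i.+1 n.+1; last by rewrite !nextv_ge.
rewrite !nextv_lt -(ffconsS x e); congr (ffcons x e _); exact: val_inj.
Qed.

(** Setting y = x = e_0 in [prodmx_path] closes the path, and the shifted reading becomes the cyclic
    successor. *)
Lemma trace_prodmx d (Q : 'I_d -> 'M[F]_p) : (0 < d)%N ->
  \tr (\prod_i Q i) =
  \sum_(e : {ffun 'I_d -> 'I_p}) \prod_i Q i (e i) (e (ordS i)).
Proof.
case: d Q => // n Q _; rewrite /mxtrace.
under [LHS]eq_bigr do rewrite prodmx_path.
rewrite (exchange_big_dep predT) //=; apply: eq_bigr => e _.
rewrite (big_pred1 (e ord0)) => [|z]; last by rewrite eq_sym.
apply: eq_bigr => i _; congr (Q _ _ _).
have := ltn_ord i; rewrite leq_eqVlt => /orP[/eqP ein|hi].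
  rewrite nextv_ge ?ein //; congr (e _); apply: val_inj.
  by rewrite /= ein modnn.
by rewrite nextv_lt; congr (e _); apply: val_inj; rewrite /= modn_small.
Qed.
End Chains.

(** In the expanded trace e_i is the last entry of block i, and L compares the first entry of block
    i with e_(i+1): this is the cyclic condition in [Sp]. *)
Lemma sum_Sp_trace p d (ks : 'I_d -> seq nat) (F : fieldType) :
    (0 < d)%N -> (forall i, ks i != [::]) ->
  \sum_(n : {dffun forall i : 'I_d, {ffun 'I_(size (ks i)) -> 'I_p}} | Sp n)
    \prod_(i < d) \prod_(j < size (ks i)) ((n i j)%:R : F) ^- nth 0%N (ks i) j
  = \tr (\prod_(i < d) (wordmx F p (ks i) * lemx F p)).
Proof.
move=> d0 ks0.
have hs i : (0 < size (ks i))%N by rewrite lt0n size_eq0.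
have hl i : ((size (ks i)).-1 < size (ks i))%N by rewrite ltn_predL.
pose j0 i := Ordinal (hs i); pose j1 i := Ordinal (hl i).
pose c i (t : {ffun 'I_(size (ks i)) -> 'I_p}) : F :=
  \prod_j (t j)%:R ^- nth 0%N (ks i) j.
have SpE (n : {dffun forall i : 'I_d, {ffun 'I_(size (ks i)) -> 'I_p}}) :
    Sp n = [forall i, increasing (n i)] &&
           [forall i, n i (j0 i) <= n (ordS i) (j1 (ordS i))]%N.
  rewrite /Sp andbA; congr andb.
    apply/andP/forallP => [[/forallP h1 /forallP h2] i|h].
      by rewrite /increasing h1 h2.
    by split; apply/forallP=> i; case/andP: (h i).
  apply/forallP/forallP => h i.
    have /forallP /(_ (j0 i)) /forallP /(_ (j1 (ordS i))) /implyP := h i.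
    by apply; rewrite /= prednK ?eqxx.
  apply/forallP => j; apply/forallP => j'.
  apply/implyP => /andP[/eqP ej /eqP ej'].
  have -> : j = j0 i by exact: val_inj.
  have -> : j' = j1 (ordS i) by apply: val_inj; have := congr1 predn ej'.
  exact: h.
rewrite trace_prodmx //.
under [RHS]eq_bigr => e _.
  under eq_bigr do
    rewrite -(@sum_increasing _ _ _ _ _ _ (j0 _) (j1 _)) ?prednK //.
  rewrite (@prod_sum_dffun _ _ _ _
    (fun i t => c i t * lemx F p (t (j0 i)) (e (ordS i)))).
  over.
rewrite (exchange_big_dep predT) //= big_mkcond /=; apply: eq_bigr => n _.
(* A family of chains fits exactly one cyclic path, made of its last entries. *)
pose e0 : {ffun 'I_d -> 'I_p} := [ffun i => n i (j1 i)].
have eE (e : {ffun 'I_d -> 'I_p}) :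
    [forall i, increasing (n i) && (n i (j1 i) == e i)] =
    [forall i, increasing (n i)] && (e == e0).
  apply/forallP/andP => [h|[/forallP h /eqP-> i]]; last by rewrite h ffunE eqxx.
  split; first by apply/forallP => i; case/andP: (h i).
  by apply/eqP/ffunP => i; rewrite ffunE; case/andP: (h i) => _ /eqP.
rewrite (eq_bigl _ _ eE).
rewrite SpE; case: ifPn => [/andP[inc /forallP le_n]|]; last first.
  have [/= inc le_n|//] := boolP [forall i, increasing (n i)];
    last by rewrite big_pred0.
  rewrite big_pred1_eq; case/forallPn: le_n => i le_n.
  by rewrite (bigD1 i) //= mxE ffunE (negPf le_n) andbF mulr0 mul0r.
rewrite inc big_pred1_eq; apply: eq_bigr => i _.
rewrite mxE ffunE le_n andbT.
by case/increasingP: (forallP inc i) => -> _; rewrite mulr1.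
Qed.

(** * The modified shuffle with y in terms of the z_k *)

Lemma shuffle_Y_Xn n :
  shuffle Y (X ^+ n) = \sum_(a < n.+1) X ^+ a * Y * X ^+ (n - a).
Proof.
have Xn m : X ^+ m = mon (nseq m lx).
  by elim: m => [|m IHm]; rewrite ?expr0 ?mon_nil // exprS IHm -mon_cat.
rewrite [in LHS]Xn shuffle_mon.
elim: n => [|n IHn].
  by rewrite shuffle_word0r big_ord1 !expr0 mul1r mulr1.
have nS : nseq n.+1 lx = rcons (nseq n lx) lx by elim: (n) => //= m <-.
(* A final letter y gives the term a = n + 1, a final x gives the others by induction. *)
rewrite -[[:: ly]]/(rcons [::] ly) nS shuffle_word_rcons -nS shuffle_word0l.
rewrite -Xn IHn.
rewrite [RHS]big_ord_recr /= subnn expr0 mulr1 addrC; congr (_ + _).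
rewrite mulr_suml; apply: eq_bigr => a _.
by rewrite subSn -1?ltnS // exprSr mulrA.
Qed.

(** The two subtracted products are the first and last terms of the sum; for n = 0 these are the
    same term, which leaves -y^2. The interior terms y x^(a+1) y x^(m-a+1) factor as y x (x^a y
    x^(m-a)) x. *)
Lemma ysh_defect_prod (R : pzRingType) (x y : R) n :
  ysh_defect (fun t => \prod_(a <- t) (y * x ^+ a.-1)) n.+1
  + (y * x ^+ n.+1) *+ 2 =
  match n with
  | 0 => - y ^+ 2
  | 1 => 0
  | m.+2 => y * x * (\sum_(a < m.+1) x ^+ a * y * x ^+ (m - a)) * x
  end.
Proof.
have p2 a b :
    \prod_(c <- [:: a; b]) (y * x ^+ c.-1) = y * x ^+ a.-1 * (y * x ^+ b.-1).
  by rewrite big_cons big_seq1.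
rewrite /ysh_defect !p2 big_seq1 subrK; under eq_bigr do rewrite p2.
case: n => [|n]; first by rewrite big_ord1 /= subrr sub0r !expr0 mulr1.
rewrite big_ord_recl big_ord_recr /=.
have -> : (n.+2 - bump 0 n = 1)%N by rewrite /bump /=; lia.
rewrite [bump 0 n]/bump add1n [y * x ^+ 0 * _ + _]addrC !addrK.
case: n => [|n]; first by rewrite big_ord0.
rewrite mulr_sumr mulr_suml; apply: eq_bigr => a _.
have -> : (n.+3 - bump 0 a = (n - a).+2)%N.
  by have := ltn_ord a; rewrite /bump /=; lia.
by rewrite /bump add1n /= exprS exprSr !mulrA.
Qed.

(** The terms 2 z_(n+1) cancel on the right; they are displayed because they yield the right-hand
    side of the theorem. *)
Lemma ysh_zE n : (0 < n)%N ->
  ysh_z n = ysh_defect (fun t => \prod_(a <- t) z a) n + z n.+1 *+ 2.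
Proof.
case: n => // n _; rewrite [RHS](ysh_defect_prod X Y).
case: n => [|[|n]]; [exact: erefl | exact: erefl |].
by rewrite -[LHS]/(Y * X * shuffle Y (X ^+ n) * X) (shuffle_Y_Xn n).
Qed.

Lemma ysh_indexE k : all (leq 1) k ->
  ysh_index k = \sum_(l < size k)
    (ysh_defect (fun t => \prod_(a <- splice k l t) z a) (nth 0%N k l)
     + (\prod_(a <- splice k l [:: (nth 0%N k l).+1]) z a) *+ 2).
Proof.
move=> /(all_nthP 0%N) k0; apply: eq_bigr => l _.
pose g : {additive H -> H} := (\prod_(a <- take l k) z a) \*o
  ((\prod_(a <- drop l.+1 k) z a) \o* idfun).
have gE t : g (\prod_(a <- t) z a) = \prod_(a <- splice k l t) z a.
  by rewrite /splice !big_cat.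
rewrite -mulrA -[LHS]/(g _) ysh_zE ?k0 // raddfD raddfMn raddf_ysh_defect.
rewrite -[z _](big_seq1 *%R) gE; congr (_ + _).
by apply: eq_ysh_defect => t _ _; exact: gE.
Qed.

(** * From traces modulo p to the identity in [A] *)

Definition zword (k : seq nat) : H := \prod_(a <- k) z a.

Lemma Zcyc_trace d (ks : 'I_d -> seq nat) :
    (0 < d)%N -> (forall i, ks i != [::]) -> (forall i, all (leq 1) (ks i)) ->
  Zcyc (tens (fun i => zword (ks i))) =
  clA (fun p =>
    \tr (\prod_(i < d) (wordmx 'F_(val p) (val p) (ks i) * lemx _ _))).
Proof.
move=> d0 ks0 ks1.
have -> : (fun i => zword (ks i)) =
          fun i => \prod_(j < size (ks i)) z (nth 0%N (ks i) j).
  by apply: funext => i; rewrite /zword (big_nth 0%N) big_mkord.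
rewrite Zcyc_tens // => [|i|i j]; first last.
- by have /(all_nthP 0%N) := ks1 i; apply.
- by rewrite lt0n size_eq0.
congr clA; apply: prodFpP => p; exact: sum_Sp_trace.
Qed.

Definition evalFp (p : primeN) (f : prodFp) : 'F_(val p) := f p.
Fact evalFp_is_zmod_morphism p : zmod_morphism (evalFp p).
Proof. by []. Qed.
HB.instance Definition _ p :=
  GRing.isZmodMorphism.Build prodFp 'F_(val p) (evalFp p)
    (evalFp_is_zmod_morphism p).

(** The trace identity holds at every prime p, so the sum of representatives vanishes in the product
    before passing to [A]. *)
Lemma sum_Zcyc_defect d (ks : 'I_d -> seq nat) :
    (0 < d)%N -> (forall i, ks i != [::]) -> (forall i, all (leq 1) (ks i)) ->
  \sum_(i < d) \sum_(l < size (ks i))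
    ysh_defect (fun t => Zcyc (tens (fun j =>
      if j == i then zword (splice (ks i) l t) else zword (ks j))))
      (nth 0%N (ks i) l) = 0.
Proof.
move=> d0 ks0 ks1.
pose f i l t : prodFp := fun p => \tr (\prod_(j < d)
  (wordmx 'F_(val p) (val p) (if j == i then splice (ks i) l t else ks j)
   * lemx _ _)).
transitivity (clA (\sum_(i < d) \sum_(l < size (ks i))
    ysh_defect (f i l) (nth 0%N (ks i) l))).
  rewrite raddf_sum; apply: eq_bigr => i _.
  rewrite raddf_sum; apply: eq_bigr => l _.
  rewrite raddf_ysh_defect; apply: eq_ysh_defect => t t0 t1 /=.
  rewrite [X in tens X](_ : _ = fun j =>
      zword (if j == i then splice (ks i) l t else ks j)); last first.
    by apply: funext => j; case: eqP.
  apply: Zcyc_trace => // j; case: (j == i) => //.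
    exact: splice_neq_nil.
  apply: all_splice => //; apply: (implyP t1).
  by have /(all_nthP 0%N) := ks1 i; apply.
rewrite -[RHS](raddf0 clA); congr clA; apply: prodFpP => p.
rewrite -[LHS]/(evalFp p _) raddf_sum.
apply: etrans (trace_ysh_defect (pchar_Fp (valP p)) ks0).
apply: eq_bigr => i _; rewrite raddf_sum; apply: eq_bigr => l _.
by rewrite raddf_ysh_defect; apply: eq_ysh_defect.
Qed.

(** Raising an entry is a splice of a list here but a case distinction in the theorem; [j] occurs
    once in the enumeration, so the two agree. *)
Lemma splice_enum r (k : 'I_r -> nat) (j : 'I_r) x :
  splice [seq k i | i <- enum 'I_r] j [:: x]
  = [seq if i == j then x else k i | i <- enum 'I_r].
Proof.
have je : (j < size (enum 'I_r))%N by rewrite size_enum_ord.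
have ee : enum 'I_r = take j (enum 'I_r) ++ j :: drop j.+1 (enum 'I_r).
  by rewrite -{1}(cat_take_drop j (enum 'I_r)) (drop_nth j) // nth_ord_enum.
have := enum_uniq 'I_r.
rewrite /splice -map_take -map_drop [in RHS]ee {1}ee.
rewrite cat_uniq /= negb_or => /and3P[_ /andP[j1 _] /andP[j2 _]].
rewrite map_cat /= eqxx; congr (_ ++ _ :: _); apply/eq_in_map => i;
  by case: eqP => // ->; rewrite ?(negPf j1) ?(negPf j2).
Qed.

Theorem mainTheorem1 (d : nat) (r : 'I_d -> nat)
    (k : forall i : 'I_d, 'I_(r i) -> nat)
    (hd : (0 < d)%N) (hr : forall i : 'I_d, (0 < r i)%N)
    (hk : forall (i : 'I_d) (j : 'I_(r i)), (0 < k i j)%N) :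
  let w (i : 'I_d) : H := \prod_(j < r i) z (k i j) in
  let w_incr (i : 'I_d) (j : 'I_(r i)) : H :=
    \prod_(j' < r i) z (if j' == j then (k i j').+1 else k i j') in
  \sum_(i < d) Zcyc (tens (fun l => if l == i then ysh (w i) else w l)) =
  2 *: \sum_(i < d) \sum_(j < r i)
         Zcyc (tens (fun l => if l == i then w_incr i j else w l)).
Proof.
move=> w w_incr; pose ks i := [seq k i j | j <- enum 'I_(r i)].
have sks i : size (ks i) = r i by rewrite size_map size_enum_ord.
have ks1 i : all (leq 1) (ks i) by apply/allP => _ /mapP[j _ ->].
have ks0 i : ks i != [::] by rewrite -size_eq0 sks -lt0n.
have wE : w = fun i => zword (ks i).
  by apply: funext => i; rewrite /zword big_map -prod_ord_enum.
have w_incrE i (j : 'I_(r i)) :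
    w_incr i j = zword (splice (ks i) j [:: (nth 0%N (ks i) j).+1]).
  rewrite /zword splice_enum big_map -prod_ord_enum; apply: eq_bigr => j' _.
  by case: eqP => // ->; rewrite (nth_map j) ?size_enum_ord ?nth_ord_enum.
(* The zero becomes the vanishing sum of defects, to be compared block by block. *)
apply/eqP; rewrite -subr_eq0 -[X in _ == X](@sum_Zcyc_defect d ks) //.
apply/eqP; rewrite scaler_sumr -sumrB; apply: eq_bigr => i _.
have [a [b ab]] := prod_update i (fun j => tens1 (w j)).
(* [Zcyc] as an additive function of block i alone. *)
pose G : {additive H -> A} := Zcyc \o (a \*o (b \o* tens1)).
have GE h : Zcyc (tens (fun l => if l == i then h else w l)) = G h.
  rewrite /G /= mulrA -ab /tens; congr Zcyc; apply: eq_bigr => j _.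
  by case: eqP.
rewrite GE {1}wE ysh_prod_z // ysh_indexE // big_split raddfD.
(* The doubled terms are the right-hand side for block i; once they cancel, only defects are
   left. *)
rewrite [X in _ + X - _](_ : _ = \sum_(j < r i)
    2 *: Zcyc (tens (fun l => if l == i then w_incr i j else w l))).
  rewrite scaler_sumr addrK raddf_sum; apply: eq_bigr => l _.
  rewrite raddf_ysh_defect; apply: eq_ysh_defect => t _ _ /=.
  by rewrite -[LHS]/(G (zword _)) -GE wE.
rewrite raddf_sum -(big_mkord xpredT (fun l =>
  G ((\prod_(c <- splice (ks i) l [:: (nth 0%N (ks i) l).+1]) z c) *+ 2))).
rewrite sks big_mkord; apply: eq_bigr => j _.
by rewrite raddfMn GE w_incrE scaler_nat.
Qed.
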